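(* Let $\mathcal{R} M = D\,\mathcal{C}$ be a proper U-match decomposition of $D\in\mathbb{K}^{m\times n}$, with matched row and column index sequences $\rho,\kappa$ and unmatched index sequences $\bar\rho,\bar\kappa$. Let $A = (\mathcal{R}_{\rho\rho})^{-1} D_{\rho\kappa} = (\mathcal{R}^{-1}D)_{\rho\kappa}$. Then the following identities hold. 1. $\mathcal{C}_{\kappa\kappa} = A^{-1} M_{\rho\kappa}$, $\ \mathcal{C}_{\kappa\bar\kappa} = -A^{-1}(\mathcal{R}_{\rho\rho})^{-1} D_{\rho\bar\kappa}$, $\ \mathcal{C}_{\bar\kappa\kappa}=0$, $\ \mathcal{C}_{\bar\kappa\bar\kappa}=I$. 2. $(\mathcal{C}^{-1})_{\kappa\mathbf{n}} = (M_{\rho\kappa})^{-1}(\mathcal{R}_{\rho\rho})^{-1} D_{\rho\mathbf{n}}$, $\ (\mathcal{C}^{-1})_{\bar\kappa\mathbf{n}} = I_{\bar\kappa\mathbf{n}}$. 3. $(\mathcal{R}^{-1})_{\bar\rho\bar\rho}=I$, $\ (\mathcal{R}^{-1})_{\bar\rho\rho} = -D_{\bar\rho\kappa}(D_{\rho\kappa})^{-1}$, $\ (\mathcal{R}^{-1})_{\rho\bar\rho}=0$, $\ (\mathcal{R}^{-1})_{\rho\rho} = (\mathcal{R}_{\rho\rho})^{-1}$. 4. $\mathcal{R}_{\mathbf{m}\bar\rho} = I_{\mathbf{m}\bar\rho}$, $\ \mathcal{R}_{\mathbf{m}\rho} = D_{\mathbf{m}\kappa}A^{-1}$.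
   Context: $\mathbb{K}$ is a field; $\mathbf{m}=(1,\dots,m)$, $\mathbf{n}=(1,\dots,n)$. For sequences of indices $\sigma=(s_1,\dots,s_p)$, $\tau=(t_1,\dots,t_q)$, $D_{\sigma\tau}$ is the $p\times q$ matrix with $D_{\sigma\tau}[i,j]=D[s_i,t_j]$. $I$ denotes an identity matrix of the appropriate size. A (generalized) matching matrix is a matrix with at most one nonzero entry in each row and each column. Upper unitriangular means upper triangular with ones on the diagonal. A U-match decomposition of $D\in\mathbb{K}^{m\times n}$ is a tuple $(\mathcal{R},M,D,\mathcal{C})$ with $\mathcal{R}M=D\mathcal{C}$, where $M\in\mathbb{K}^{m\times n}$ is a matching matrix and $\mathcal{R}\in\mathbb{K}^{m\times m}$, $\mathcal{C}\in\mathbb{K}^{n\times n}$ are upper unitriangular. Its index matching is $\mu=\{(r,c): M[r,c]\ne 0\}$. Let $\rho=(\rho_1<\dots<\rho_k)$ be the row indices occurring in $\mu$ (matched rows), $\bar\rho$ the increasing sequence of the remaining (unmatched) row indices, $\kappa=(\kappa_1<\dots<\kappa_k)$ the column indices occurring in $\mu$ (matched columns), and $\bar\kappa$ the increasing sequence of the remaining column indices. The decomposition is proper if (A1) whenever $\mathrm{col}_k(M)=0$, $\mathrm{row}_k(\mathcal{C})$ is the $k$th standard unit row vector; and (A2) whenever $\mathrm{row}_k(M)=0$, $\mathrm{col}_k(\mathcal{R})$ is the $k$th standard unit column vector. *)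

(* Defs.v *)
From mathcomp Require Import all_boot all_order all_algebra.
Import GRing.Theory.

Set Implicit Arguments.
Unset Strict Implicit.
Unset Printing Implicit Defensive.

Local Open Scope ring_scope.

(* Indices are 0-based, and a sequence of p indices is a p.-tuple. The full
   sequence of all indices of 'I_n, in order, is [ord_tuple n]. *)
Definition submatrix (K : fieldType) (m n p q : nat) (D : 'M[K]_(m, n))
    (s : p.-tuple 'I_m) (t : q.-tuple 'I_n) : 'M[K]_(p, q) :=
  mxsub (tnth s) (tnth t) D.

Definition matching_mx (K : fieldType) (m n : nat) (M : 'M[K]_(m, n)) : Prop :=
  (forall i j j', M i j != 0 -> M i j' != 0 -> j = j') /\
  (forall j i i', M i j != 0 -> M i' j != 0 -> i = i').

(* [is_trig_mx] means lower triangular, hence the transpose. *)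
Definition upper_unitriangular (K : fieldType) (n : nat) (U : 'M[K]_n) : Prop :=
  is_trig_mx U^T /\ (forall i, U i i = 1).

Definition umatch (K : fieldType) (m n : nat)
    (R : 'M[K]_m) (M D : 'M[K]_(m, n)) (C : 'M[K]_n) : Prop :=
  [/\ matching_mx M, upper_unitriangular R, upper_unitriangular C
    & R *m M = D *m C].

Definition proper_umatch (K : fieldType) (m n : nat)
    (R : 'M[K]_m) (M D : 'M[K]_(m, n)) (C : 'M[K]_n) : Prop :=
  [/\ umatch R M D C,
      forall k : 'I_n, col k M = 0 -> row k C = delta_mx 0 k
    & forall k : 'I_m, row k M = 0 -> col k R = delta_mx k 0].

Definition index_matching (K : fieldType) (m n : nat) (M : 'M[K]_(m, n)) :
    {set 'I_m * 'I_n} :=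
  [set rc | M rc.1 rc.2 != 0].

Definition matched_rows (K : fieldType) (m n : nat) (M : 'M[K]_(m, n)) :
    {set 'I_m} :=
  [set rc.1 | rc in index_matching M].

Definition matched_cols (K : fieldType) (m n : nat) (M : 'M[K]_(m, n)) :
    {set 'I_n} :=
  [set rc.2 | rc in index_matching M].

Definition increasing_enum (n p : nat) (S : {set 'I_n}) (s : p.-tuple 'I_n) :
    Prop :=
  sorted ltn [seq val i | i <- s] /\ s =i S.

(* Main.v *)
Require Import Defs.
From mathcomp Require Import all_boot all_order all_algebra.
Import GRing.Theory.
Local Open Scope ring_scope.

(** Properness says that the rows of C indexed by kappabar, and the columns of
    R indexed by rhobar, are those of the identity; hence so are those of the
    inverses of C and R. Splitting the products in R M = D C,
    R^-1 D = M C^-1, R^-1 R = 1 and C C^-1 = 1 along rho, rhobar and along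
    kappa, kappabar then makes the off-diagonal terms collapse, and every
    identity follows by cancelling an invertible block. *)

Lemma increasing_enum_uniq {n p : nat} {S : {set 'I_n}} {s : p.-tuple 'I_n} :
  increasing_enum S s -> uniq s.
Proof.
case=> ss _; rewrite -(map_inj_uniq val_inj).
exact: sorted_uniq ltn_trans ltnn _ ss.
Qed.

Lemma sum_increasing_enum {V : nmodType} {n p q : nat} {S : {set 'I_n}}
    {s : p.-tuple 'I_n} {t : q.-tuple 'I_n} (F : 'I_n -> V) :
    increasing_enum S s -> increasing_enum (~: S) t ->
  \sum_i F i = \sum_i F (tnth s i) + \sum_i F (tnth t i).
Proof.
move=> hs ht; rewrite (bigID [in S]) /= -!(big_tuple _ _ _ xpredT F).
rewrite !big_uniq ?(increasing_enum_uniq hs) ?(increasing_enum_uniq ht) //=.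
case: hs ht => _ Ss [_ St].
by congr (_ + _); apply: eq_bigl => i; rewrite ?Ss ?St ?inE.
Qed.

Section Submatrix.

Context {K : fieldType}.

(** Block multiplication without permuting the matrices into block form: the inner sum splits over
    [S] and its complement. All later block identities come from this one. *)
Lemma submatrix_mul {m n l a b p q : nat} {S : {set 'I_n}}
    {s : p.-tuple 'I_n} {t : q.-tuple 'I_n} (X : 'M[K]_(m, n))
    (Y : 'M[K]_(n, l)) (u : a.-tuple 'I_m) (v : b.-tuple 'I_l) :
    increasing_enum S s -> increasing_enum (~: S) t ->
  submatrix (X *m Y) u v =
    submatrix X u s *m submatrix Y s v + submatrix X u t *m submatrix Y t v.
Proof.
move=> hs ht; apply/matrixP=> i j; rewrite !mxE (sum_increasing_enum _ hs ht).
by congr (_ + _); apply: eq_bigr => x _; rewrite !mxE.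
Qed.

Lemma submatrix1 {n p : nat} {S : {set 'I_n}} {s : p.-tuple 'I_n} :
  increasing_enum S s -> submatrix (1%:M : 'M[K]_n) s s = 1%:M.
Proof.
move=> /increasing_enum_uniq/tuple_uniqP inj_s.
by apply/matrixP=> i j; rewrite !mxE (inj_eq inj_s).
Qed.

Lemma submatrix1_disjoint {n p q : nat} {S : {set 'I_n}}
    {s : p.-tuple 'I_n} {t : q.-tuple 'I_n} :
    increasing_enum S s -> increasing_enum (~: S) t ->
  submatrix (1%:M : 'M[K]_n) s t = 0 /\ submatrix (1%:M : 'M[K]_n) t s = 0.
Proof.
move=> [_ Ss] [_ St].
have ne i j : tnth s i != tnth t j.
  apply: contraTneq (mem_tnth i s) => ->.
  by rewrite Ss -in_setC -St mem_tnth.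
split; apply/matrixP=> i j; rewrite !mxE; last rewrite eq_sym.
  by rewrite (negPf (ne _ _)).
by rewrite (negPf (ne _ _)).
Qed.

Lemma upper_unitriangular_unitmx {n : nat} {U : 'M[K]_n} :
  upper_unitriangular U -> U \in unitmx.
Proof.
case=> Utrig U1; rewrite -unitmx_tr unitmxE det_trig // big1 ?unitr1 // => i _.
by rewrite mxE U1.
Qed.

Lemma matching_mx_unitmx {k : nat} {M : 'M[K]_k} :
  matching_mx M -> (forall i, exists j, M i j != 0) -> M \in unitmx.
Proof.
move=> [rowM colM] M0.
(* the inverse is the transpose with inverted entries, as 0^-1 = 0 *)
have MN : M *m (\matrix_(i, j) (M j i)^-1) = 1%:M.
  apply/matrixP=> i i'; have [j Mij] := M0 i; rewrite !mxE (bigD1 j) //= big1.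
    rewrite mxE addr0; have [<-|ne] := eqVneq i i'; first by rewrite divff.
    have /eqP-> : M i' j == 0 by apply: contraNT ne => /(colM _ _ _ Mij)->.
    by rewrite invr0 mulr0.
  move=> j' ne; have /eqP-> : M i j' == 0; last by rewrite mul0r.
  by apply: contraNT ne => /(rowM _ _ _ Mij)->.
by have [] := mulmx1_unit MN.
Qed.

Lemma index_matched {m n : nat} (M : 'M[K]_(m, n)) (i : 'I_m) (j : 'I_n) :
  M i j != 0 -> i \in matched_rows M /\ j \in matched_cols M.
Proof.
by move=> Mij; split; apply/imsetP; exists (i, j) => //; rewrite inE.
Qed.

Lemma col_unmatched0 {m n : nat} {M : 'M[K]_(m, n)} {j : 'I_n} :
  j \notin matched_cols M -> col j M = 0.
Proof.
move=> Mj; apply/matrixP=> i z; rewrite !mxE.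
by apply: contraNeq Mj => /index_matched[].
Qed.

Lemma row_unmatched0 {m n : nat} {M : 'M[K]_(m, n)} {i : 'I_m} :
  i \notin matched_rows M -> row i M = 0.
Proof.
move=> Mi; apply/matrixP=> z j; rewrite !mxE.
by apply: contraNeq Mi => /index_matched[].
Qed.

Lemma increasing_enumC_notin {n p : nat} {S : {set 'I_n}} {s : p.-tuple 'I_n}
    (i : 'I_p) : increasing_enum (~: S) s -> tnth s i \notin S.
Proof. by case=> _ Ss; rewrite -in_setC -Ss mem_tnth. Qed.

(** The nonzero entry of a matched row lies in a matched column, so restricting to [rho] and [kappa]
    loses no nonzero entry; injectivity of the two enumerations keeps the matching property. *)
Lemma submatrix_matched_unitmx {m n k : nat} {M : 'M[K]_(m, n)}
    {rho : k.-tuple 'I_m} {kappa : k.-tuple 'I_n} :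
    matching_mx M -> increasing_enum (matched_rows M) rho ->
    increasing_enum (matched_cols M) kappa ->
  submatrix M rho kappa \in unitmx.
Proof.
move=> [rowM colM] hrho hkappa.
have /tuple_uniqP inj_rho := increasing_enum_uniq hrho.
have /tuple_uniqP inj_kappa := increasing_enum_uniq hkappa.
apply: matching_mx_unitmx => [|i].
  split=> [i j j'|j i i']; rewrite !mxE => Mij Mij'.
    exact/inj_kappa/(rowM _ _ _ Mij).
  exact/inj_rho/(colM _ _ _ Mij).
have : tnth rho i \in matched_rows M by rewrite -hrho.2 mem_tnth.
case/imsetP=> -[r c]; rewrite inE /= => Mrc ri.
have : c \in kappa by rewrite hkappa.2; have [] := index_matched _ _ _ Mrc.
by case/tnthP=> j cj; exists j; rewrite mxE ri -cj.
Qed.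

End Submatrix.

Theorem mainTheorem1 (K : fieldType) (m n : nat)
    (R : 'M[K]_m) (M D : 'M[K]_(m, n)) (C : 'M[K]_n)
    (k p q : nat)
    (rho : k.-tuple 'I_m) (rhobar : p.-tuple 'I_m)
    (kappa : k.-tuple 'I_n) (kappabar : q.-tuple 'I_n)
    (hproper : proper_umatch R M D C)
    (hrho : increasing_enum (matched_rows M) rho)
    (hrhobar : increasing_enum (~: matched_rows M) rhobar)
    (hkappa : increasing_enum (matched_cols M) kappa)
    (hkappabar : increasing_enum (~: matched_cols M) kappabar) :
  let Rrr := submatrix R rho rho in
  let Mrk := submatrix M rho kappa in
  let Drk := submatrix D rho kappa in
  let A := invmx Rrr *m Drk in
  (* every inverse occurring below is a genuine inverse *)
  (R \in unitmx /\ C \in unitmx /\ Rrr \in unitmx /\ Mrk \in unitmx /\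
   Drk \in unitmx /\ A \in unitmx) /\
  A = submatrix (invmx R *m D) rho kappa /\
  (* 1 *)
  [/\ submatrix C kappa kappa = invmx A *m Mrk,
      submatrix C kappa kappabar =
        - (invmx A *m invmx Rrr *m submatrix D rho kappabar),
      submatrix C kappabar kappa = 0
    & submatrix C kappabar kappabar = 1%:M] /\
  (* 2 *)
  (submatrix (invmx C) kappa (ord_tuple n) =
     invmx Mrk *m invmx Rrr *m submatrix D rho (ord_tuple n) /\
   submatrix (invmx C) kappabar (ord_tuple n) =
     submatrix 1%:M kappabar (ord_tuple n)) /\
  (* 3 *)
  [/\ submatrix (invmx R) rhobar rhobar = 1%:M,
      submatrix (invmx R) rhobar rho =
        - (submatrix D rhobar kappa *m invmx Drk),
      submatrix (invmx R) rho rhobar = 0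
    & submatrix (invmx R) rho rho = invmx Rrr] /\
  (* 4 *)
  (submatrix R (ord_tuple m) rhobar = submatrix 1%:M (ord_tuple m) rhobar /\
   submatrix R (ord_tuple m) rho =
     submatrix D (ord_tuple m) kappa *m invmx A).
Proof.
move=> Rrr Mrk Drk A.
case: hproper => -[matchM /upper_unitriangular_unitmx uR].
move=> /upper_unitriangular_unitmx uC RM_DC rowC colR.
have uMrk : Mrk \in unitmx by apply: submatrix_matched_unitmx.
have RV_MV : invmx R *m D = M *m invmx C.
  by rewrite -[M](mulKmx uR) RM_DC -!mulmxA (mulmxV uC) mulmx1.
have M_rhobar l (t : l.-tuple 'I_n) : submatrix M rhobar t = 0.
  apply/matrixP=> i j.
  have /row_unmatched0/rowP/(_ (tnth t j)) := increasing_enumC_notin i hrhobar.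
  by rewrite !mxE.
have M_kappabar l (s : l.-tuple 'I_m) : submatrix M s kappabar = 0.
  apply/matrixP=> i j.
  have /col_unmatched0/colP/(_ (tnth s i)) := increasing_enumC_notin j hkappabar.
  by rewrite !mxE.
have R_rhobar l (s : l.-tuple 'I_m) :
    submatrix R s rhobar = submatrix 1%:M s rhobar.
  apply/matrixP=> i j.
  have /row_unmatched0/colR/colP/(_ (tnth s i)) :=
    increasing_enumC_notin j hrhobar.
  by rewrite !mxE andbT.
have C_kappabar l (t : l.-tuple 'I_n) :
    submatrix C kappabar t = submatrix 1%:M kappabar t.
  apply/matrixP=> i j.
  have /col_unmatched0/rowC/rowP/(_ (tnth t j)) :=
    increasing_enumC_notin i hkappabar.
  by rewrite !mxE /= eq_sym.
have [I_rho_rhobar I_rhobar_rho] :=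
  @submatrix1_disjoint K _ _ _ _ _ _ hrho hrhobar.
have [I_kappa_kappabar I_kappabar_kappa] :=
  @submatrix1_disjoint K _ _ _ _ _ _ hkappa hkappabar.
have I_rhobar := @submatrix1 K _ _ _ _ hrhobar.
have I_kappabar := @submatrix1 K _ _ _ _ hkappabar.
(* Restrict R^-1 R = 1 to the columns [rhobar]: there R agrees with the identity, so the product is
   just the columns [rhobar] of R^-1. *)
have RV_rhobar l (s : l.-tuple 'I_m) :
    submatrix (invmx R) s rhobar = submatrix 1%:M s rhobar.
  have := submatrix_mul (invmx R) R s rhobar hrho hrhobar.
  by rewrite mulVmx // !R_rhobar I_rho_rhobar I_rhobar mulmx0 add0r mulmx1.
have CV_kappabar l (t : l.-tuple 'I_n) :
    submatrix (invmx C) kappabar t = submatrix 1%:M kappabar t.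
  have := submatrix_mul C (invmx C) kappabar t hkappa hkappabar.
  rewrite mulmxV // !C_kappabar I_kappabar_kappa I_kappabar.
  by rewrite mul0mx add0r mul1mx.
(* The block of R at (rho, rhobar) vanishes, so R R^-1 = 1 gives the square block [Rrr] a right
   inverse, which is then its inverse. *)
have RV_rho : Rrr *m submatrix (invmx R) rho rho = 1%:M.
  have := submatrix_mul R (invmx R) rho rho hrho hrhobar.
  rewrite mulmxV // R_rhobar I_rho_rhobar mul0mx addr0 => <-.
  exact: submatrix1 hrho.
have [uRrr _] := mulmx1_unit RV_rho.
have RVrr : submatrix (invmx R) rho rho = invmx Rrr.
  by rewrite -[LHS](mulKmx uRrr) RV_rho mulmx1.
(* With t = [kappa] this is the second form of A; with t all columns it serves item 2. *)
have RVD l (t : l.-tuple 'I_n) :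
    submatrix (invmx R *m D) rho t = invmx Rrr *m submatrix D rho t.
  rewrite (submatrix_mul _ _ _ _ hrho hrhobar) RV_rhobar I_rho_rhobar.
  by rewrite mul0mx addr0 RVrr.
(* With s = [rho] this yields the invertibility of [Drk] and the formula for the (kappa, kappa)
   block of C; with s all rows it yields item 4. *)
have RM_kappa l (s : l.-tuple 'I_m) :
    submatrix R s rho *m Mrk = submatrix D s kappa *m submatrix C kappa kappa.
  have := submatrix_mul R M s kappa hrho hrhobar.
  rewrite RM_DC (submatrix_mul _ _ _ _ hkappa hkappabar) M_rhobar C_kappabar.
  by rewrite I_kappabar_kappa !mulmx0 !addr0.
(* Their product equals [Rrr *m Mrk], which is invertible; for square matrices this forces both
   factors to be invertible. *)
have [uDrk uCkk] : Drk \in unitmx /\ submatrix C kappa kappa \in unitmx.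
  by apply/andP; rewrite -unitmx_mul -RM_kappa unitmx_mul uRrr.
have uA : A \in unitmx by rewrite unitmx_mul unitmx_inv uRrr.
have Ckk : submatrix C kappa kappa = invmx A *m Mrk.
  apply: (canRL (mulKmx uA)).
  by rewrite -mulmxA -RM_kappa mulKmx.
split; first by [].
split; first by rewrite RVD.
split.
  split=> //; rewrite ?C_kappabar //.
  (* Columns [kappabar] of M vanish, so this block of R M = D C reads 0 = D_{rho kappa} C_{kappa
     kappabar} + D_{rho kappabar}. *)
  have := submatrix_mul R M rho kappabar hrho hrhobar.
  rewrite RM_DC (submatrix_mul _ _ _ _ hkappa hkappabar) !M_kappabar.
  rewrite C_kappabar I_kappabar !mulmx0 addr0 mulmx1 => /eqP.
  rewrite addr_eq0 => /eqP DC0.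
  by rewrite -[LHS](mulKmx uA) -(mulmxA (invmx Rrr)) DC0 !mulmxN mulmxA.
split.
  split; last exact: CV_kappabar.
  rewrite -mulmxA -RVD RV_MV (submatrix_mul _ _ _ _ hkappa hkappabar).
  by rewrite M_kappabar mul0mx addr0 mulKmx.
split.
  split=> //; rewrite ?RV_rhobar //.
  (* Dually, rows [rhobar] of M vanish, so this block of R^-1 D = M C^-1 reads (R^-1)_{rhobar rho}
     D_{rho kappa} + D_{rhobar kappa} = 0. *)
  have := submatrix_mul M (invmx C) rhobar kappa hkappa hkappabar.
  rewrite -RV_MV (submatrix_mul _ _ _ _ hrho hrhobar) !M_rhobar !mul0mx addr0.
  rewrite RV_rhobar I_rhobar mul1mx => /eqP; rewrite addr_eq0 => /eqP RVD0.
  by rewrite -mulNmx -RVD0 mulmxK.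
split; first exact: R_rhobar.
by rewrite -[LHS](mulmxK uMrk) RM_kappa Ckk mulmxA mulmxK.
Qed.
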